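(* Let $\mathbb{V}=U\oplus W$ be a finite-dimensional vector space over a field $\mathcal{F}$, where $U$ and $W$ are nonzero subspaces and $\dim(\mathbb{V})\geq 3$. Then the independence number of the direct sum graph $\Gamma_{U\oplus W}(\mathbb{V})$ is $\dim(U)\dim(W)$.
   Context: Let $\mathbb{V}$ be a vector space over a field $\mathcal{F}$ with $\mathbb{V}=U\oplus W$, where $U,W$ are nonzero subspaces, $\dim U=r$, $\dim W=s$, $r+s=n=\dim\mathbb{V}$. Fix a basis $\{\alpha_1,\dots,\alpha_r\}$ of $U$ and a basis $\{\beta_1,\dots,\beta_s\}$ of $W$; every $x\in\mathbb{V}$ is written uniquely as $x=a_1\alpha_1+\dots+a_r\alpha_r+b_1\beta_1+\dots+b_s\beta_s$. The direct sum graph $\Gamma_{U\oplus W}(\mathbb{V})$ is the simple graph whose vertex set is $\{x=u+w: u\in U, w\in W, u\neq 0, w\neq 0\}$, in which two distinct vertices $x,y$ are adjacent iff there is an index $i$ such that the coefficient of $\alpha_i$ is nonzero in both $x$ and $y$, and there is an index $j$ such that the coefficient of $\beta_j$ is nonzero in both $x$ and $y$. The independence number is the maximum size of a set of pairwise non-adjacent vertices. *)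

(* Defs.v *)
From HB Require Import structures.
From mathcomp Require Import all_boot all_order all_algebra.
From mathcomp Require Import boolp classical_sets functions cardinality.

Set Implicit Arguments.
Unset Strict Implicit.
Unset Printing Implicit Defensive.

Import GRing.Theory.
Local Open Scope ring_scope.
Local Open Scope classical_set_scope.
Local Open Scope card_scope.

(* The vertex set may be infinite. *)
Record sgraph (T : Type) := SGraph {
  vertices : set T;
  adj : T -> T -> Prop;
  adj_vertices : forall x y, adj x y -> vertices x /\ vertices y;
  adj_irrefl : forall x, ~ adj x x;
  adj_sym : forall x y, adj x y -> adj y x
}.

Definition independent (T : Type) (G : sgraph T) (S : set T) : Prop :=
  S `<=` vertices G /\ forall x y, S x -> S y -> x <> y -> ~ adj G x y.

(* The upper bound ranges over arbitrary sets, so in particular it says that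
   G has no infinite independent set. *)
Definition is_independence_number (T : Type) (G : sgraph T) (k : nat) : Prop :=
  (exists S : set T, independent G S /\ S #= `I_k) /\
  (forall S : set T, independent G S -> S #<= `I_k).

Section DirectSumGraph.
Variables (F : fieldType) (V : vectType F) (U W : {vspace V}) (r s : nat).
Variables (alpha : r.-tuple V) (beta : s.-tuple V).

(* These are the coefficients of x on the family alpha ++ beta; they are
   meaningful when alpha and beta are bases of complementary subspaces. *)
Definition coef_alpha (i : 'I_r) (x : V) : F :=
  coord [tuple of alpha ++ beta] (lshift s i) x.

Definition coef_beta (j : 'I_s) (x : V) : F :=
  coord [tuple of alpha ++ beta] (rshift r j) x.

Definition dsum_vertices : set V :=
  [set x | exists u w, [/\ u \in U, w \in W, u != 0, w != 0 & x = u + w]].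

Definition dsum_adj (x y : V) : Prop :=
  [/\ dsum_vertices x, dsum_vertices y, x <> y,
      (exists i, coef_alpha i x != 0 /\ coef_alpha i y != 0)
    & (exists j, coef_beta j x != 0 /\ coef_beta j y != 0)].

Fact dsum_adj_vertices x y :
  dsum_adj x y -> dsum_vertices x /\ dsum_vertices y.
Proof. by case. Qed.

Fact dsum_adj_irrefl x : ~ dsum_adj x x.
Proof. by case. Qed.

Fact dsum_adj_sym x y : dsum_adj x y -> dsum_adj y x.
Proof.
case=> vx vy nxy [i [ix iy]] [j [jx jy]]; split=> //.
- by move=> yx; apply: nxy.
- by exists i.
- by exists j.
Qed.

Definition direct_sum_graph : sgraph V :=
  SGraph dsum_adj_vertices dsum_adj_irrefl dsum_adj_sym.

End DirectSumGraph.

(* Main.v *)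
(** The supports of a vertex [x] on the bases of [U] and [W] are non-empty sets
    [A] and [B] of indices, and two distinct vertices are non-adjacent exactly
    when the boxes [A * B] are disjoint.  An independent set therefore has at
    most as many elements as there are cells in the [\dim U] by [\dim W] grid,
    and the vectors [alpha_i + beta_j], whose boxes are the single cells, reach
    that bound. *)
Require Import Defs.
From mathcomp Require Import all_boot all_order all_algebra.
From mathcomp Require Import boolp classical_sets functions cardinality.

Set Implicit Arguments.
Unset Strict Implicit.
Unset Printing Implicit Defensive.

Import GRing.Theory.

Lemma card_setT_fintype (T : finType) : ([set: T] #= `I_#|T|)%card.
Proof.
rewrite (card_eqr card_II) card_eq_sym.
have -> : [set: 'I_#|T|]%classic = (enum_rank @` [set: T])%classic.
  by apply/seteqP; split=> // i _; exists (enum_val i) => //; rewrite enum_valK.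
by apply: inj_card_eq => x y _ _; exact: enum_rank_inj.
Qed.

(** Choosing for each element of [S] some related [i] gives an injection into [I], because no [i]
    serves two elements. Below, [R x p] will mean that the cell [p] lies in the box of [x]. *)
Lemma card_le_fintype (T : Type) (I : finType) (S : set T) (R : T -> I -> Prop) :
  (forall x, S x -> exists i, R x i) ->
  (forall x y i, S x -> S y -> R x i -> R y i -> x = y) ->
  (S #<= `I_#|I|)%card.
Proof.
move=> Rtot Rinj; rewrite -(card_le_eqr (card_setT_fintype I)).
(* [I] may be empty when [S] is; otherwise [i0] is the default value of [f] outside [S]. *)
case: (pselect (S = set0)) => [->|/eqP/set0P [x0 /Rtot[i0 _]]].
  exact: card_ge0.
have /choice[f fP] x : exists i, S x -> R x i.
  have [/Rtot[i Ri]|nSx] := pselect (S x); first by exists i.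
  by exists i0.
have finj : {in S &, injective f}.
  move=> x y; rewrite !inE => Sx Sy fxy.
  by apply: (Rinj x y (f x)) => //; [exact: fP | rewrite fxy; exact: fP].
by rewrite -(card_le_eql (inj_card_eq finj)); exact: subset_card_le.
Qed.

Section DirectSumCoefficients.
Local Open Scope ring_scope.
Variables (F : fieldType) (V : vectType F) (U W : {vspace V}) (r s : nat).
Variables (alpha : r.-tuple V) (beta : s.-tuple V).
Hypothesis dxUW : directv (U + W).
Hypotheses (basisU : basis_of U alpha) (basisW : basis_of W beta).

Lemma basis_coord_neq0 (n : nat) (X : n.-tuple V) (A : {vspace V}) v :
  basis_of A X -> v \in A -> v != 0 -> exists i, coord X i v != 0.
Proof.
move=> bX Av; rewrite {1}(coord_basis bX Av) => nz.
apply/existsP; apply: contraNT nz; rewrite negb_exists => /forallP cv0.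
rewrite big1 // => i _.
by have /eqP -> := negbNE (cv0 i); rewrite scale0r.
Qed.

Let free_cat : free (alpha ++ beta).
Proof. exact: basis_free (cat_basis dxUW basisU basisW). Qed.

Let c u w (k : 'I_(r + s)) : F :=
  match fintype.split k with inl i => coord alpha i u | inr j => coord beta j w end.

Let sum_c u w : u \in U -> w \in W ->
  u + w = \sum_k c u w k *: [tuple of alpha ++ beta]`_k.
Proof.
move=> Uu Ww; rewrite big_split_ord /= {1}(coord_basis basisU Uu).
rewrite {1}(coord_basis basisW Ww); congr (_ + _); apply: eq_bigr => i _.
  by rewrite /c (unsplitK (inl i)) /= nth_cat size_tuple ltn_ord.
by rewrite /c (unsplitK (inr i)) /= nth_cat size_tuple ltnNge leq_addr addKn.
Qed.

(** [sum_c] expands [u + w] on the free family [alpha ++ beta], whose coordinates are unique, so the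
    first [r] of them come from [u] alone. *)
Lemma coef_alphaD i u w : u \in U -> w \in W ->
  coef_alpha alpha beta i (u + w) = coord alpha i u.
Proof.
move=> Uu Ww; rewrite /coef_alpha sum_c // coord_sum_free // /c.
by rewrite (unsplitK (inl i)).
Qed.

Lemma coef_betaD j u w : u \in U -> w \in W ->
  coef_beta alpha beta j (u + w) = coord beta j w.
Proof.
move=> Uu Ww; rewrite /coef_beta sum_c // coord_sum_free // /c.
by rewrite (unsplitK (inr j)).
Qed.

Let alphaU (i : 'I_r) : alpha`_i \in U.
Proof. by apply: (basis_mem basisU); rewrite mem_nth ?size_tuple. Qed.

Let betaW (j : 'I_s) : beta`_j \in W.
Proof. by apply: (basis_mem basisW); rewrite mem_nth ?size_tuple. Qed.

Lemma coef_alpha_cell (i i' : 'I_r) (j : 'I_s) :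
  coef_alpha alpha beta i' (alpha`_i + beta`_j) = (i == i')%:R.
Proof. by rewrite coef_alphaD // coord_free // (basis_free basisU). Qed.

Lemma coef_beta_cell (i : 'I_r) (j j' : 'I_s) :
  coef_beta alpha beta j' (alpha`_i + beta`_j) = (j == j')%:R.
Proof. by rewrite coef_betaD // coord_free // (basis_free basisW). Qed.

Lemma cell_vertex (i : 'I_r) (j : 'I_s) :
  dsum_vertices U W (alpha`_i + beta`_j).
Proof.
have nth_neq0 n (X : n.-tuple V) (k : 'I_n) : free X -> X`_k != 0.
  by move=> fX; apply: free_not0 fX _; rewrite mem_nth ?size_tuple.
exists alpha`_i, beta`_j; split=> //.
  exact/nth_neq0/(basis_free basisU).
exact/nth_neq0/(basis_free basisW).
Qed.

Lemma dsum_vertex_cell x : dsum_vertices U W x ->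
  exists p : 'I_r * 'I_s,
    coef_alpha alpha beta p.1 x != 0 /\ coef_beta alpha beta p.2 x != 0.
Proof.
case=> u [w [Uu Ww u0 w0 ->]].
have [i iu] := basis_coord_neq0 basisU Uu u0.
have [j jw] := basis_coord_neq0 basisW Ww w0.
by exists (i, j); rewrite coef_alphaD // coef_betaD.
Qed.

Lemma direct_sum_independence_number :
  is_independence_number (direct_sum_graph U W alpha beta) (r * s).
Proof.
(* The bound becomes the cardinal of the grid ['I_r * 'I_s]. *)
rewrite -[r in (r * _)%N]card_ord -[s in (_ * s)%N]card_ord -card_prod; split.
  pose cell (p : 'I_r * 'I_s) := alpha`_p.1 + beta`_p.2.
  have bool_neq0 (b : bool) : b%:R != 0 :> F -> b by case: b; rewrite ?eqxx.
  have cell_inj : injective cell.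
    move=> [i j] [i' j'] /= eq_cell; congr (_, _); apply/eqP/bool_neq0.
      (* The coefficient at [i'] of the common vector is [(i == i')%:R] in one form and [1] in the
         other. *)
      rewrite -(coef_alpha_cell i i' j) [X in coef_alpha _ _ _ X]eq_cell.
      by rewrite coef_alpha_cell eqxx oner_eq0.
    rewrite -(coef_beta_cell i j j') [X in coef_beta _ _ _ X]eq_cell.
    by rewrite coef_beta_cell eqxx oner_eq0.
  exists (cell @` setT)%classic; split; last first.
    rewrite -(card_eqr (card_setT_fintype _)).
    by apply: inj_card_eq => p q _ _; exact: cell_inj.
  split=> [_ [p _ <-]|]; first exact: cell_vertex.
  move=> _ _ [[i j] _ <-] [[i' j'] _ <-] neq [_ _ _ [k [ik ik']] [l [jl jl']]].
  apply: neq; move: ik ik' jl jl'; rewrite !coef_alpha_cell !coef_beta_cell /=.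
  (* A shared index [k] equals both [i] and [i'], and [l] equals both [j] and [j']: the two cells
     coincide. *)
  by do 4!move/bool_neq0/eqP->.
move=> S [Svert Sind].
apply: (card_le_fintype
  (R := fun x (p : 'I_r * 'I_s) =>
    coef_alpha alpha beta p.1 x != 0 /\ coef_beta alpha beta p.2 x != 0)).
  by move=> x /Svert/dsum_vertex_cell.
move=> x y [i j] Sx Sy [/= ix jx] [iy jy].
(* A cell [(i, j)] common to two boxes provides both indices that adjacency asks for. *)
have [//|nxy] := pselect (x = y); case: (Sind x y Sx Sy nxy).
by split=> //; [exact: Svert | exact: Svert | exists i | exists j].
Qed.

End DirectSumCoefficients.

Theorem theorem2p6 (F : fieldType) (V : vectType F) (U W : {vspace V})
    (alpha : (\dim U).-tuple V) (beta : (\dim W).-tuple V)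
    (hsum : (U + W)%VS = fullv) (hdirect : directv (U + W))
    (hU : U <> 0%VS) (hW : W <> 0%VS)
    (halpha : basis_of U alpha) (hbeta : basis_of W beta)
    (hdim : 3 <= \dim (fullv : {vspace V})) :
  is_independence_number (direct_sum_graph U W alpha beta) (\dim U * \dim W).
Proof. exact: direct_sum_independence_number. Qed.
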